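(* Let $k\ge1$ be an integer and let $A^n$ be the Toeplitz matrices associated with $M_k=[(z-w)^k]$. For every $n\ge0$ and $0\le\ell\le n$, the algebraic cofactor of the entry in row $n$ and column $\ell$ of $A^n$ is \[ A^n_{n,\ell}=D_n\,\frac{\binom{k+\ell}{k}\binom{k+n-\ell-1}{k-1}}{\binom{k+n}{k}}. \] In particular, every algebraic cofactor in the last row is positive.
   Context: $H^2(\mathbb D^2)$ is the Hardy space over the bidisk, in which the monomials $z^aw^b$ ($a,b\ge0$) form an orthonormal basis. Let $p_k=(z-w)^k$. For $n\ge0$, $A^n$ is the $(n+1)\times(n+1)$ Gram matrix $A^n=\left(\langle p_kz^iw^{n-i},p_kz^jw^{n-j}\rangle\right)_{i,j=0}^n$, with rows and columns indexed from $0$ to $n$; equivalently, its $(i,j)$ entry is $(-1)^{|i-j|}\binom{2k}{k-|i-j|}$ if $|i-j|\le k$ and $0$ otherwise. $A^n_{i,j}=(-1)^{i+j}\det A^n(i|j)$, where $A^n(i|j)$ is obtained from $A^n$ by deleting row $i$ and column $j$ (the determinant of the empty matrix is $1$, so $A^0_{0,0}=1$). Put $D_0=1$ and $D_n=\det A^{n-1}$ for $n\ge1$. *)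

(* Defs.v *)
From HB Require Import structures.
From mathcomp Require Import all_boot all_order all_algebra.
From mathcomp Require Import reals complex mpoly.

Set Implicit Arguments.
Unset Strict Implicit.
Unset Printing Implicit Defensive.

Import Order.TTheory GRing.Theory Num.Theory.
Local Open Scope ring_scope.

(* [R[i]], for [R : realType], is the field of complex numbers; its order is
   such that [0 < x] means that [x] is real and positive. *)

Definition zvar (R : realType) : {mpoly R[i][2]} := 'X_0.
Definition wvar (R : realType) : {mpoly R[i][2]} := 'X_1.
Arguments zvar {R}.
Arguments wvar {R}.

(* The inner product of H^2(D^2) on the dense subspace C[z, w]: the one,
   linear in its first argument, for which the monomials are orthonormal. *)
Definition hardy_inner (R : realType) (f g : {mpoly R[i][2]}) : R[i] :=
  \sum_(m <- msupp f) f@_m * (g@_m)^*.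

Lemma hardy_inner_monomials (R : realType) (a b c d : nat) :
  hardy_inner (zvar ^+ a * wvar ^+ b : {mpoly R[i][2]}) (zvar ^+ c * wvar ^+ d)
  = ((a == c) && (b == d))%:R.
Proof.
have monoE (x y : nat) : (zvar ^+ x * wvar ^+ y : {mpoly R[i][2]})
    = 'X_[[multinom (if i == ord0 :> 'I_2 then x else y) | i < 2]].
  rewrite [RHS]mpolyXE_id big_ord_recl big_ord1 !mnmE /=.
  by congr (_ ^+ _ * 'X_ _ ^+ _); apply/val_inj.
rewrite /hardy_inner !monoE msuppX big_seq1 !mcoeffX eqxx mul1r rmorph_nat.
congr (nat_of_bool _)%:R; apply/eqP/andP => [/mnmP e | [/eqP -> /eqP ->]] //.
by have := e ord0; have := e 1; rewrite !mnmE /= => -> ->; rewrite !eqxx.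
Qed.

Definition pk (R : realType) (k : nat) : {mpoly R[i][2]} := (zvar - wvar) ^+ k.

Definition gram (R : realType) (k n : nat) : 'M[R[i]]_n.+1 :=
  \matrix_(i < n.+1, j < n.+1)
    hardy_inner (pk R k * (zvar ^+ i * wvar ^+ (n - i)))
                (pk R k * (zvar ^+ j * wvar ^+ (n - j))).

Definition gram_det (R : realType) (k n : nat) : R[i] :=
  if n is m.+1 then \det (gram R k m) else 1.

(* Main.v *)
Require Import Defs.
From HB Require Import structures.
From mathcomp Require Import all_boot all_order all_algebra.
From mathcomp Require Import reals complex mpoly.
From mathcomp Require Import zify ring.

(** With [p = (k! (k-1)!)^-1 prod_{a<k} (X - a) prod_{a<k-1} (X - (n+k+1+a))], of degree
    [2k-1], the value [p(l+k)] is, up to the sign [(-1)^(k-1)], the numerator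
    [u_l = C(k+l,k) C(k+n-l-1,k-1)]. Row [i] of the Gram matrix consists, up to
    the sign [(-1)^k], of the coefficients of a [2k]-th difference centred at [i],
    which annihilates [p]; as [p] vanishes at the integers of [[i, i+2k]] outside
    [[k, n+k]], except at [n+2k] when [i = n], we get [A^n u = d e_n] with [d > 0].
    Multiplying by the adjugate gives [det A^n u_l = d A^n_{n,l}]; the case [l = n]
    reads [D_{n+1} C(k+n,k) = d D_n], whence [D_n > 0] by induction, and dividing
    the two relations gives the formula. *)

Set Implicit Arguments.
Unset Strict Implicit.
Unset Printing Implicit Defensive.

Import Order.TTheory GRing.Theory Num.Theory.
Local Open Scope ring_scope.

(** * Finite differences of polynomials *)

Lemma size_forward_diff (F : idomainType) (p : {poly F}) :
  (size (p - (p \Po ('X + 1)))%R <= (size p).-1)%N.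
Proof.
have sX1 : size ('X + 1 : {poly F}) = 2%N by rewrite size_XaddC.
have szc : size (p \Po ('X + 1)) = size p by rewrite size_comp_poly2.
apply/leq_sizeP => j; rewrite leq_eqVlt => /orP[/eqP <-|lt_pj].
  (* Translation by [1] preserves size and leading coefficient, so the top coefficients cancel. *)
  have := lead_coef_comp p (_ : (1 < size (('X + 1)%R : {poly F}))%N).
  rewrite sX1 lead_coefXaddC expr1n mulr1 => /(_ isT).
  by rewrite !lead_coefE szc => lcE; rewrite coefB lcE subrr.
have le_pj : (size p <= j)%N by move: lt_pj; case: (size p).
by rewrite coefB !nth_default ?szc ?subrr.
Qed.

(** Induction on [N]: by Pascal's rule the sum of order [N + 1] for [p] is the sum of order [N] for
    [p - p(X + 1)], whose size is smaller. *)
Lemma alternating_binomial_sum_horner (F : idomainType) N (p : {poly F}) x :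
  (size p <= N)%N ->
  \sum_(s < N.+1) (-1) ^+ s * 'C(N, s)%:R * p.[x + s%:R] = 0.
Proof.
elim: N p => [|N IHN] p.
  rewrite leqn0 size_poly_eq0 => /eqP->; rewrite big1 // => s _.
  by rewrite horner0 mulr0.
move=> szp; rewrite big_ord_recl /= -[RHS](IHN (p - (p \Po ('X + 1)))); last first.
  by apply: leq_trans (size_forward_diff p) _; case: (size p) szp.
under [RHS]eq_bigr => s _.
  rewrite hornerD hornerN horner_comp hornerD hornerX hornerC mulrBr -addrA natr1.
over.
rewrite sumrB [X in _ = X - _]big_ord_recl /= !bin0 -addrA; congr (_ + _).
(* The range may be extended by one term, because ['C(N, N + 1) = 0]. *)
have -> : \sum_(i < N) (-1) ^+ bump 0 i * 'C(N, bump 0 i)%:R * p.[x + (bump 0 i)%:R]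
   = \sum_(i < N.+1) (-1) ^+ i.+1 * 'C(N, i.+1)%:R * p.[x + i.+1%:R].
  by rewrite big_ord_recr /= bin_small // mulr0 mul0r addr0; apply: eq_bigr.
rewrite -sumrB; apply: eq_bigr => s _.
by rewrite /bump /= add1n binS natrD exprS; ring.
Qed.

(** Indexes a difference based at [i] by the absolute node [m = i + s], so that the zeros of [p] can
    be cut off in the same way for every row. *)
Lemma big_shift_support (F : nmodType) (f : nat -> F) i N M :
  (i + N <= M)%N -> (forall s, (N <= s)%N -> f s = 0) ->
  \sum_(s < N) f s = \sum_(0 <= m < M) (if (i <= m)%N then f (m - i)%N else 0).
Proof.
move=> leM f0; rewrite (big_cat_nat (n := i)) //=; last by lia.
rewrite [X in _ = X + _]big_nat [X in _ = X + _]big1 ?add0r; last first.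
  by move=> m h; case: ifP => //; lia.
rewrite (big_cat_nat (n := (i + N)%N)) //=; last by lia.
rewrite [X in _ = _ + X]big_nat [X in _ = _ + X]big1 ?addr0; last first.
  by move=> m /andP[h _]; rewrite f0 ?if_same //; lia.
rewrite [(i + N)%N]addnC -{1}[ i ]add0n big_addn addnK big_mkord.
apply: eq_bigr => s _.
by rewrite leq_addl addnK.
Qed.

(** * The polynomial [p] and the vector it yields, with [r = k - 1] *)

Section ToeplitzKernel.
Variables (F : numFieldType) (r n : nat).
Let k := r.+1.

(* Nodes are shifted by [k]: the point [m] stands for the index [l = m - k]. *)
Definition kernel_roots : seq F :=
  [seq a%:R | a <- iota 0 k ++ iota (n + k).+1 r].

(** Monic form of [p]; the factor [k! r!] is divided out in [toeplitz_kernel]. *)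
Definition kernel_poly : {poly F} := \prod_(c <- kernel_roots) ('X - c%:P).

Lemma size_kernel_poly : size kernel_poly = k.*2.
Proof.
rewrite size_prod_XsubC size_map size_cat !size_iota /k; lia.
Qed.

Lemma kernel_poly_root m :
  (m < k)%N || (n + k < m < n + k.*2)%N -> kernel_poly.[m%:R] = 0.
Proof.
move=> hm; apply/eqP; rewrite -/(root _ _) root_prod_XsubC.
by apply: map_f; rewrite mem_cat !mem_iota; move: hm; rewrite /k; lia.
Qed.

Lemma kernel_poly_gt0 : 0 < kernel_poly.[(n + k.*2)%:R].
Proof.
rewrite horner_prod big_map big_seq; apply: prodr_gt0 => a.
rewrite hornerXsubC subr_gt0 ltr_nat mem_cat !mem_iota /k; lia.
Qed.

(** Each block of roots gives a falling factorial; the [r] factors of the upper block are negative,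
    whence the sign. *)
Lemma kernel_poly_horner l : (l <= n)%N ->
  kernel_poly.[(l + k)%:R]
  = (-1) ^+ r * (k`! * r`!)%:R * ('C(k + l, k)%:R * 'C(r + n - l, r)%:R).
Proof.
move=> le_ln; rewrite horner_prod big_map big_cat /=.
have -> : \prod_(i <- iota 0 k) ('X - (i%:R : F)%:P).[(l + k)%:R]
        = ('C(k + l, k) * k`!)%:R.
  rewrite bin_ffact ffact_prod natr_prod -[k in iota 0 k]subn0 -/(index_iota 0 k).
  rewrite big_mkord; apply: eq_bigr => i _.
  by rewrite hornerXsubC addnC natrB //; have := ltn_ord i; lia.
have -> : \prod_(i <- iota (n + k).+1 r) ('X - (i%:R : F)%:P).[(l + k)%:R]
        = (-1) ^+ r * ('C(r + n - l, r) * r`!)%:R.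
  rewrite bin_ffact ffact_prod natr_prod -[r in (-1) ^+ r]card_ord -prodrN.
  have -> : iota (n + k).+1 r = index_iota (n + k).+1 ((n + k).+1 + r).
    by rewrite /index_iota addKn.
  rewrite -[X in index_iota X _]add0n big_addn addKn big_mkord.
  (* Upper roots are taken from the largest down, in the order of the falling factorial. *)
  rewrite (reindex_inj rev_ord_inj); apply: eq_bigr => i _ /=.
  rewrite hornerXsubC -opprB -natrB; last by lia.
  by congr (- _%:R); have := ltn_ord i; lia.
by rewrite !natrM; ring.
Qed.

(** This is [(-1)^|i-l| C(2k, k-|i-l|)], indexed by the position [l + k - i] in the difference based
    at [i]. The guard stops truncated subtraction from giving [C(2k, 0) = 1]; for [l > i + k] the
    binomial vanishes. *)
Definition toeplitz_entry (i l : nat) : F :=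
  if (i <= l + k)%N then (-1) ^+ (k + (l + k - i)) * 'C(k.*2, l + k - i)%:R else 0.

Lemma toeplitz_kernel i : (i <= n)%N ->
  \sum_(l < n.+1) toeplitz_entry i l * ('C(k + l, k)%:R * 'C(r + n - l, r)%:R)
  = if i == n then kernel_poly.[(n + k.*2)%:R] / (k`! * r`!)%:R else 0.
Proof.
move=> le_in.
have fN0 : (k`! * r`!)%:R != 0 :> F by rewrite pnatr_eq0 -lt0n muln_gt0 !fact_gt0.
pose f s : F := (-1) ^+ s * 'C(k.*2, s)%:R * kernel_poly.[i%:R + s%:R].
have f0 s : (k.*2.+1 <= s)%N -> f s = 0.
  by move=> lt; rewrite /f bin_small // mulr0 mul0r.
have := alternating_binomial_sum_horner i%:R (eq_leq size_kernel_poly).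
rewrite (@big_shift_support _ f i _ (n + k.*2).+1) //; last by lia.
(* The node [n + 2k], not a root, is split off; the roots below [k] and above [n + k] drop out,
   leaving the nodes [l + k]. *)
rewrite big_nat_recr //= (big_cat_nat (n := k)) //=; last by lia.
rewrite big_nat big1 ?add0r; last first.
  move=> m ltm; case: ifP => // le_im.
  by rewrite /f -natrD subnKC // kernel_poly_root ?mulr0 //; lia.
rewrite (big_cat_nat (n := (n.+1 + k))) //=; [|by lia|by rewrite /k; lia].
rewrite [X in _ + X + _ = _]big_nat [X in _ + X + _ = _]big1 ?addr0; last first.
  move=> m /andP[lem ltm]; case: ifP => // le_im.
  rewrite /f -natrD subnKC // kernel_poly_root ?mulr0 //; lia.
have -> : (i <= n + k.*2)%N by lia.
rewrite -{1}[k]add0n big_addn addnK big_mkord => /eqP.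
rewrite addr_eq0 => /eqP sumE.
apply: (mulfI fN0).
(* The sign [(-1)^k] of the entries and [(-1)^r] of the values of [p] multiply to [-1]. *)
transitivity (- \sum_(l < n.+1) (if (i <= l + k)%N then f (l + k - i)%N else 0)).
  rewrite mulr_sumr -sumrN; apply: eq_bigr => l _; rewrite /toeplitz_entry.
  case: ifP => le_il; last by rewrite mul0r mulr0 oppr0.
  rewrite /f -natrD subnKC // kernel_poly_horner -1?ltnS //.
  rewrite [in LHS]exprD {1}/k exprS.
  by ring.
rewrite sumE opprK /f -natrD subnKC; last by lia.
(* The node [n + 2k] has position [n + 2k - i], which is [2k] for [i = n] and beyond the difference
   for [i < n]. *)
case: eqP => [->|neq_in].
  by rewrite addKn binn -mul2n exprM sqrrN !expr1n !mul1r mulrC divfK.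
by rewrite bin_small ?mulr0 ?mul0r //; lia.
Qed.

End ToeplitzKernel.

(** * Gram entries computed from the inner product *)

Lemma hardy_inner_wider (R : realType) (f g : {mpoly R[i][2]}) s :
  uniq s -> {subset msupp f <= s} ->
  hardy_inner f g = \sum_(m <- s) f@_m * (g@_m)^*.
Proof.
move=> us fs; rewrite (bigID (mem (msupp f))) /= [X in _ + X]big1 ?addr0.
  rewrite -big_filter; apply: perm_big; apply: uniq_perm; rewrite ?filter_uniq //.
  by move=> m; rewrite mem_filter; case: (boolP (m \in msupp f)) => //= /fs.
by move=> m /memN_msupp_eq0 ->; rewrite mul0r.
Qed.

Lemma hardy_inner_suml (R : realType) (I : finType) (c : I -> R[i])
    (f : I -> {mpoly R[i][2]}) g :
  hardy_inner (\sum_i c i *: f i) g = \sum_i c i * hardy_inner (f i) g.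
Proof.
(* The range [msupp] depends on the first argument, so all the inner products are put over one
   common list. *)
pose s := undup (msupp (\sum_i c i *: f i) ++ flatten [seq msupp (f i) | i <- enum I]).
have us : uniq s by rewrite undup_uniq.
rewrite (@hardy_inner_wider _ _ _ s) //; last first.
  by move=> m hm; rewrite mem_undup mem_cat hm.
under [RHS]eq_bigr => i _.
  rewrite (@hardy_inner_wider _ _ _ s) //; last first.
    move=> m hm; rewrite mem_undup mem_cat; apply/orP; right.
    by apply/flattenP; exists (msupp (f i)) => //; apply: map_f; rewrite mem_enum.
  rewrite mulr_sumr.
over.
rewrite exchange_big; apply: eq_bigr => m _ /=.
rewrite raddf_sum mulr_suml; apply: eq_bigr => i _.
by rewrite /= mcoeffZ mulrA.
Qed.

Lemma hardy_inner_sumr (R : realType) (I : finType) (c : I -> R[i])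
    f (g : I -> {mpoly R[i][2]}) :
  hardy_inner f (\sum_i c i *: g i) = \sum_i (c i)^* * hardy_inner f (g i).
Proof.
under [RHS]eq_bigr => i _ do rewrite mulr_sumr.
rewrite exchange_big; apply: eq_bigr => m _ /=.
rewrite raddf_sum rmorph_sum mulr_sumr; apply: eq_bigr => i _.
by rewrite /= mcoeffZ rmorphM mulrCA.
Qed.

Lemma Vandermonde_pairs k s :
  (\sum_(b < k.+1) \sum_(a < k.+1) (a + b == s) * ('C(k, b) * 'C(k, a))
   = 'C(k.*2, s))%N.
Proof.
rewrite -addnn -binomial.Vandermonde.
transitivity (\sum_(b < (k + s).+1) if (b <= s)%N then 'C(k, b) * 'C(k, s - b) else 0)%N.
  rewrite (big_ord_widen (k + s).+1
    (fun b => \sum_(a < k.+1) (a + b == s) * ('C(k, b) * 'C(k, a)))%N); last by lia.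
  rewrite big_mkcond; apply: eq_bigr => b _ /=.
  case: ltnP => hb; last by rewrite bin_small //= mul0n if_same.
  case: leqP => hbs; last by rewrite big1 // => a _; case: eqP => //; lia.
  case: (leqP (s - b) k) => hsk; last first.
    rewrite (bin_small hsk) muln0 big1 // => a _.
    by case: eqP => //; have := ltn_ord a; lia.
  have hs : (s - b < k.+1)%N by [].
  rewrite (bigD1 (Ordinal hs)) //= big1 ?addn0 ?subnK ?eqxx ?mul1n //.
  by move=> a; rewrite -val_eqE /= => /eqP ne; case: eqP => //; lia.
rewrite (big_ord_widen (k + s).+1 (fun b => 'C(k, b) * 'C(k, s - b))%N); last by lia.
by rewrite [RHS]big_mkcond.
Qed.

Lemma pk_mul_expand (R : realType) k i j :
  pk R k * (zvar ^+ i * wvar ^+ j)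
  = \sum_(b < k.+1) ((-1) ^+ (k - b) * 'C(k, b)%:R)
      *: (zvar ^+ (b + i) * wvar ^+ (k - b + j)).
Proof.
rewrite /pk addrC exprDn mulr_suml; apply: eq_bigr => b _.
rewrite [(- wvar) ^+ _]exprNn -mul_mpolyC rmorphM rmorph_sign rmorph_nat !exprD -mulr_natl.
by ring.
Qed.

(** Used for the second argument, so that matching exponents fixes the sum [a + b], as in
    Vandermonde's convolution, and not a difference. *)
Lemma pk_mul_expand_rev (R : realType) k i j :
  pk R k * (zvar ^+ i * wvar ^+ j)
  = \sum_(a < k.+1) ((-1) ^+ a * 'C(k, a)%:R)
      *: (zvar ^+ (k - a + i) * wvar ^+ (a + j)).
Proof.
rewrite pk_mul_expand (reindex_inj rev_ord_inj); apply: eq_bigr => a _ /=.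
have le_ak : (a <= k)%N by rewrite -ltnS.
by rewrite subSS bin_sub // subKn.
Qed.

Lemma gramE (R : realType) r n (i j : 'I_n.+1) :
  gram R r.+1 n i j = toeplitz_entry _ r i j.
Proof.
rewrite mxE /toeplitz_entry; set k := r.+1.
rewrite pk_mul_expand pk_mul_expand_rev hardy_inner_suml.
have [le_in le_jn] : (i <= n /\ j <= n)%N by split; rewrite -ltnS.
transitivity (\sum_(b < k.+1) \sum_(a < k.+1)
    (if (i <= j + k)%N then (-1) ^+ (k + (j + k - i))
       * ((a + b == j + k - i)%N * ('C(k, b) * 'C(k, a)))%:R else 0 : R[i])).
  apply: eq_bigr => b _; rewrite hardy_inner_sumr mulr_sumr; apply: eq_bigr => a _.
  have [le_bk le_ak] : (b <= k /\ a <= k)%N by split; rewrite -ltnS.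
  rewrite hardy_inner_monomials rmorphM rmorph_sign rmorph_nat.
  (* Both monomials have total degree [k + n], so the two exponent equations reduce to one. *)
  have -> : ((b + i == k - a + j) && (k - b + (n - i) == a + (n - j)))%N
            = (i <= j + k)%N && (a + b == j + k - i)%N by lia.
  case: (leqP i (j + k)) => hij /=; last by rewrite !mulr0.
  case: eqP => [<-|_] /=; last by rewrite mul0n !mulr0.
  have -> : (-1) ^+ (k + (a + b)) = (-1) ^+ (k - b) * (-1) ^+ a :> R[i].
    rewrite -signr_odd -exprD -[RHS]signr_odd !oddD oddB //.
    by case: (odd k); case: (odd a); case: (odd b).
  by rewrite mulr1 mul1n natrM; ring.
case: ifP => _; last by rewrite big1 // => b _; rewrite big1.
rewrite -Vandermonde_pairs natr_sum mulr_sumr; apply: eq_bigr => b _.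
by rewrite natr_sum mulr_sumr.
Qed.

(** * Cofactors of the last row *)

Lemma cofactor_gram_max (R : realType) r n :
  cofactor (gram R r.+1 n) ord_max ord_max = gram_det R r.+1 n.
Proof.
rewrite /cofactor -signr_odd oddD addbb mul1r.
case: n => [|n]; first by rewrite det_mx00.
(* By [gramE] an entry depends only on its indices, not on the size of the matrix. *)
by congr (\det _); apply/matrixP => i j; rewrite [LHS]mxE [LHS]mxE !gramE !lift_max.
Qed.


(** The last column of the adjugate holds the cofactors of the last row of [A]. *)
Lemma cofactor_of_kernel (F : comPzRingType) n (A : 'M[F]_n.+1) (u : 'I_n.+1 -> F) d :
  (forall i, \sum_l A i l * u l = if i == ord_max then d else 0) ->
  forall l, \det A * u l = cofactor A ord_max l * d.
Proof.
move=> Au l.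
have AuE : A *m (\col_j u j) = \col_i (if i == ord_max then d else 0).
  by apply/colP => i; rewrite !mxE -Au; apply: eq_bigr => j _; rewrite mxE.
have /colP/(_ l) : \det A *: (\col_j u j) = \adj A *m (\col_i (if i == ord_max then d else 0)).
  by rewrite -AuE mulmxA mul_adj_mx mul_scalar_mx.
rewrite !mxE => ->; rewrite (bigD1 ord_max) //= !mxE eqxx big1 ?addr0 //.
by move=> i /negbTE ne; rewrite !mxE ne mulr0.
Qed.

Section GramCofactor.
Variables (R : realType) (r : nat).
Let k := r.+1.
Let d n : R[i] := (kernel_poly _ r n).[(n + k.*2)%:R] / (k`! * r`!)%:R.

Let d_gt0 n : 0 < d n.
Proof. by rewrite divr_gt0 ?kernel_poly_gt0 // ltr0n muln_gt0 !fact_gt0. Qed.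

Let det_gramE n (l : 'I_n.+1) :
  \det (gram R k n) * ('C(k + l, k)%:R * 'C(r + n - l, r)%:R)
  = cofactor (gram R k n) ord_max l * d n.
Proof.
apply: (cofactor_of_kernel (u := fun l : 'I_n.+1 => 'C(k + l, k)%:R * 'C(r + n - l, r)%:R)).
move=> i; rewrite -val_eqE /= -toeplitz_kernel -1?ltnS //.
by apply: eq_bigr => j _; rewrite gramE.
Qed.

Let det_gram_rec n : \det (gram R k n) * 'C(k + n, k)%:R = gram_det R k n * d n.
Proof. by rewrite -cofactor_gram_max -det_gramE /= addnK binn mulr1. Qed.

Lemma gram_det_gt0 n : 0 < gram_det R k n.
Proof.
elim: n => [|n IHn] //=.
have C0 : 0 < 'C(k + n, k)%:R :> R[i] by rewrite ltr0n bin_gt0 leq_addr.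
by rewrite -(pmulr_lgt0 _ C0) det_gram_rec mulr_gt0.
Qed.

Lemma cofactor_gram n (l : 'I_n.+1) :
  cofactor (gram R k n) ord_max l
  = gram_det R k n * (('C(k + l, k)%:R * 'C(r + n - l, r)%:R) / 'C(k + n, k)%:R).
Proof.
have C0 : 'C(k + n, k)%:R != 0 :> R[i] by rewrite pnatr_eq0 -lt0n bin_gt0 leq_addr.
rewrite mulrA; apply: (mulIf C0); rewrite divfK //.
(* Cleared of [C(k+n, k)] and [d n], both sides become [det A^n u_l C(k+n, k)]. *)
apply: (mulIf (lt0r_neq0 (d_gt0 n))).
by rewrite mulrAC -det_gramE [RHS]mulrAC -det_gram_rec; ring.
Qed.

End GramCofactor.

Theorem theorem3p2 (R : realType) (k : nat) (hk : (1 <= k)%N)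
    (n : nat) (l : 'I_n.+1) :
  cofactor (gram R k n) ord_max l
    = gram_det R k n
      * (('C(k + l, k)%:R * 'C(k + n - l - 1, k - 1)%:R) / 'C(k + n, k)%:R)
  /\ 0 < cofactor (gram R k n) ord_max l.
Proof.
case: k hk => // r _.
have le_ln : (l <= n)%N by rewrite -ltnS.
have -> : (r.+1 + n - l - 1 = r + n - l)%N by lia.
rewrite subn1 cofactor_gram; split=> //.
by rewrite mulr_gt0 ?gram_det_gt0 // divr_gt0 ?mulr_gt0 // ltr0n bin_gt0; lia.
Qed.
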